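(* Let $a>0$ and let $n\ge 2$ be an integer, and let $w(x)=1/|x-ai|$ for $x\in\mathbb{R}$. Any $n$-point weighted Fekete point set $\mathcal{F}_n^w$ for $w$ on $\mathbb{R}$ has the form $$\mathcal{F}_n^w=\{x_1,\dots,x_n\}=\{a\tan(\gamma+k\pi/n):\ k=0,1,\ldots,n-1\},$$ where $\gamma\in(-\pi/2,-\pi/2+\pi/n)$. Equivalently, the weighted Fekete points are the roots of the monic polynomial $$F(x)=\frac{1}{2an}\Big((an-Bi)(x+ai)^n+(an+Bi)(x-ai)^n\Big),$$ where $$B=-a\sum_{k=0}^{n-1}\tan(\gamma+k\pi/n)=an\cot(n\pi/2+n\gamma).$$ Moreover, $$\delta_n^w(\mathbb{R})=\frac{n^{1/(n-1)}}{2a}.$$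
   Context: Here $i$ is the imaginary unit. For a closed set $E\subset\mathbb{C}$, a continuous weight $w:E\to[0,\infty)$ and an integer $n\ge2$, the $n$th weighted diameter is $$\delta_n^w(E):=\sup_{Z_n\subset E}\left(\prod_{1\le j<k\le n}|z_j-z_k|\,w(z_j)w(z_k)\right)^{\frac{2}{n(n-1)}}=\sup_{Z_n\subset E}\left(|V(Z_n)|^{\frac{2}{n(n-1)}}\prod_{k=1}^n w(z_k)^{2/n}\right),$$ where the supremum is over all $n$-point sets $Z_n=\{z_k\}_{k=1}^n\subset E$ and $V(Z_n)=\prod_{1\le j<k\le n}(z_j-z_k)$ is the Vandermonde determinant. A set of $n$ points $\mathcal{F}_n^w\subset E$ that attains this supremum is called an ($n$th) weighted Fekete point set for $w$ on $E$. *)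

(* Defs.v *)
From mathcomp Require Import all_boot all_order all_algebra.
From mathcomp Require Import complex.
From mathcomp Require Import all_classical all_reals all_analysis.

Set Implicit Arguments.
Unset Strict Implicit.
Unset Printing Implicit Defensive.

Import Order.TTheory GRing.Theory Num.Theory.

Local Open Scope classical_set_scope.
Local Open Scope ring_scope.
Local Open Scope complex_scope.

(* The modulus of a complex number, as an element of R; on R[i] the norm
   `|z| takes its values in R[i]. *)
Definition cmod (R : realType) (z : R[i]) : R := complex.Re `|z|.

Definition cot (R : realType) (x : R) : R := cos x / sin x.

Definition real_line (R : realType) : set R[i] := range (fun x : R => x%:C).

(* An n-point set {z_1, ..., z_n} is presented by an injective enumeration
   z : 'I_n -> R[i]; wprod does not depend on the enumeration chosen. *)
Definition npoints (R : realType) (E : set R[i]) (n : nat) (z : 'I_n -> R[i]) :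
    Prop :=
  injective z /\ forall k, E (z k).

Definition wprod (R : realType) (w : R[i] -> R) (n : nat) (z : 'I_n -> R[i]) :
    R :=
  (\prod_(j < n) \prod_(k < n | (j < k)%N)
     (cmod (z j - z k) * w (z j) * w (z k))) `^ (2 / (n * n.-1)%:R).

(* The supremum is taken in \bar R, so that it is +oo when the products are
   unbounded. Only the values of w on E matter. *)
Definition wdiam (R : realType) (E : set R[i]) (w : R[i] -> R) (n : nat) :
    \bar R :=
  ereal_sup [set (wprod w z)%:E | z in @npoints R E n].

Definition is_fekete (R : realType) (E : set R[i]) (w : R[i] -> R) (n : nat)
    (F : set R[i]) : Prop :=
  exists z : 'I_n -> R[i],
    [/\ npoints E z, F = range z & (wprod w z)%:E = wdiam E w n].

Definition wgt (R : realType) (a : R) (z : R[i]) : R :=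
  (cmod (z - (0 +i* a)))^-1.

Definition tan_points (R : realType) (a : R) (n : nat) (gamma : R) :
    set R[i] :=
  [set (a * tan (gamma + k%:R * pi / n%:R))%:C | k in `I_n].

Definition Bcoef (R : realType) (a : R) (n : nat) (gamma : R) : R :=
  - a * \sum_(k < n) tan (gamma + k%:R * pi / n%:R).

Definition fekete_poly (R : realType) (a : R) (n : nat) (B : R) :
    {poly R[i]} :=
  (2 * a * n%:R)^-1%:C *:
    ((a * n%:R -i* B) *: ('X + (0 +i* a)%:P) ^+ n +
     (a * n%:R +i* B) *: ('X - (0 +i* a)%:P) ^+ n).

(* Main.v *)
Require Import Defs.
From mathcomp Require Import all_boot all_order all_algebra.
From mathcomp Require Import complex.
From mathcomp Require Import all_classical all_reals all_analysis.
From mathcomp Require Import ring lra.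

Import Order.TTheory GRing.Theory Num.Theory.

Local Open Scope classical_set_scope.
Local Open Scope ring_scope.

(** The Cayley transform u(x) = (x + ai)/(x - ai) maps the real line
    injectively into the unit circle, and it turns the weight into plain
    distance:
      |x_j - x_k| w(x_j) w(x_k) = |u_j - u_k| / (2a)   (weighted_distance).
    So the extremal problem asks to maximise the modulus of the Vandermonde
    determinant of n points u_k of the unit circle.

    Hadamard's inequality solves it, with its equality case.  Let M be the
    matrix with rows (1, u_k, ..., u_k^(n-1)) and G = M M^*.  The Gram matrix G
    has diagonal entries n, so the inequality between the geometric and
    arithmetic means of its eigenvalues gives |det M|^2 = det G <= n^n, with
    equality iff G = n I (leif_det_gram).  An off-diagonal entry of G is the
    geometric sum of the powers of u_j/u_k, which vanishes for u_j != u_k iff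
    u_j^n = u_k^n.  Hence n distinct points are extremal iff all the u_k^n
    coincide (leif_Vandermonde_circle, leif_wprod).

    Now write x = a tan t with -pi/2 < t < pi/2.  Then u(x) = e^(i(pi - 2t)),
    so u(a tan s)^n = u(a tan t)^n means sin(n(t - s)) = 0, i.e. s and t differ
    by a multiple of pi/n (cayley_tan_eq).  The n angles of an extremal set
    therefore form an arithmetic progression of step pi/n that fits in the open
    interval of length pi; its least term is gamma (fekete_angles).
    Conversely every such progression is extremal, which gives the value of the
    weighted diameter.

    Finally, put phi = n pi/2 + n gamma and B = an cot(phi).  Since x + ai and
    x - ai are the conjugate numbers (a / cos t) e^(+-i(pi/2 - t)), the value
    F(a tan t) is proportional to sin(phi + n(pi/2 - t)), so F vanishes at the n
    points of the progression; being monic of degree n, it is the product of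
    the corresponding linear factors (fekete_poly_prod).  Its coefficient of
    degree n - 1 is B when read off the definition and minus the sum of the
    roots when read off the product: this is the identity between the cotangent
    and the sum of tangents (Bcoef_cot). *)

(** * Hadamard's inequality for Vandermonde determinants on the unit circle *)

Section Hadamard.
Local Open Scope sesquilinear_scope.

(** Geometric versus arithmetic mean for the eigenvalues of the Gram matrix:
    they are nonnegative, with product |det M|^2 and sum tr G, and they are all
    equal to their mean iff G is the corresponding scalar matrix. *)
Lemma leif_det_gram {C : numClosedFieldType} {n : nat} (M : 'M[C]_n)
    (G := M *m M ^t*) :
  `|\det M| ^+ 2 <= (\tr G / n%:R) ^+ n
    ?= iff (G == (\tr G / n%:R)%:M).
Proof.
have detG : \det G = `|\det M| ^+ 2.
  by rewrite det_mulmx det_map_mx det_tr -normCK.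
have hermG : G \is hermsymmx.
  apply/is_hermitianmxP.
  by rewrite expr0 scale1r trmx_mul map_mxM trmxCK.
have /orthomx_spectralP := hermitian_normalmx hermG.
set P := spectralmx G; set D := spectral_diag G => eqG.
have Puni : P \is unitarymx := spectral_unitarymx G.
have Punit : P \in unitmx := spectral_unit G.
have D_PM : diag_mx D = (P *m M) *m (P *m M) ^t*.
  rewrite trmx_mul map_mxM mulmxA -(mulmxA P) -/G -invmx_unitary //.
  by rewrite eqG !mulmxA mulmxV // mul1mx -mulmxA mulmxV // mulmx1.
have D_ge0 i : 0 <= D 0 i.
  have /matrixP/(_ i i) := D_PM; rewrite !mxE eqxx mulr1n => ->.
  by apply: sumr_ge0 => j _; rewrite !mxE -normCK exprn_ge0.
have detGD : \det G = \prod_(i in 'I_n) D 0 i.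
  rewrite eqG !det_mulmx mulrAC -det_mulmx mulVmx // det1 mul1r det_diag.
  by apply: eq_bigl => i; rewrite inE.
have trGD : \tr G = \sum_(i in 'I_n) D 0 i.
  rewrite eqG mxtrace_mulC mulmxA mulmxV // mul1mx mxtrace_diag.
  by apply: eq_bigl => i; rewrite inE.
have := @leif_AGM _ 'I_n 'I_n (D 0) (fun i _ => D_ge0 i).
rewrite -detGD -trGD detG card_ord => AGM.
suff <- : [forall i in 'I_n, forall j in 'I_n, D 0 i == D 0 j] =
          (G == (\tr G / n%:R)%:M) by [].
apply/idP/eqP => [/forall_inP eqD | Gscal].
  have [n0 | n_gt0] := posnP n.
    by apply/matrixP => i; have := ltn_ord i; rewrite [X in (_ < X)%N]n0.
  have eqDmu i : D 0 i = \tr G / n%:R.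
    rewrite trGD (eq_bigr (fun=> D 0 i)) => [|j _]; last first.
      by have /forall_inP/(_ i isT)/eqP := eqD j isT.
    rewrite sumr_const card_ord -[X in X / _]mulr_natr mulfK //.
    by rewrite pnatr_eq0 -lt0n.
  rewrite [LHS]eqG.
  have -> : diag_mx D = (\tr G / n%:R)%:M.
    by apply/matrixP => i j; rewrite !mxE eqDmu.
  by rewrite mul_mx_scalar -scalemxAl mulVmx // scalemx1.
apply/forall_inP => i _; apply/forall_inP => j _.
have eqDi k : D 0 k = \tr G / n%:R.
  have /matrixP/(_ k k) : diag_mx D = (\tr G / n%:R)%:M.
    rewrite D_PM trmx_mul map_mxM mulmxA -(mulmxA P) -/G -invmx_unitary //.
    by rewrite {1}Gscal mul_mx_scalar -scalemxAl mulmxV // scalemx1.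
  by rewrite !mxE eqxx !mulr1n.
by rewrite !eqDi.
Qed.

(** Equality in the Gram bound makes the off-diagonal entries
    1 + (u_i/u_j) + ... + (u_i/u_j)^(n-1) vanish, hence (u_i/u_j)^n = 1.
    Injectivity is essential to the converse: a repeated point makes the
    determinant vanish although the n-th powers may agree. *)
Lemma leif_Vandermonde_circle {C : numClosedFieldType} {n : nat}
    {u : 'I_n -> C} : injective u -> (forall i, `|u i| = 1) ->
  `|\prod_(i < n) \prod_(j < n | (i < j)%N) (u j - u i)| ^+ 2 <= n%:R ^+ n
    ?= iff [forall i, forall j, u i ^+ n == u j ^+ n].
Proof.
move=> u_inj u1.
have u_neq0 i : u i != 0 by rewrite -normr_gt0 u1 ltr01.
have conju i : (u i)^* = (u i)^-1.
  by apply: (mulfI (u_neq0 i)); rewrite -normCK u1 expr1n divff.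
pose M := (Vandermonde n (\row_i u i))^T.
have GE i j : (M *m M ^t*) i j = \sum_(k < n) (u i / u j) ^+ k.
  rewrite mxE; apply: eq_bigr => k _; rewrite !mxE rmorphXn /= conju.
  by rewrite exprMn.
have G_diag i : (M *m M ^t*) i i = n%:R.
  rewrite GE divff // (eq_bigr (fun=> 1)) => [|k _]; last exact: expr1n.
  by rewrite sumr_const card_ord.
have mu : \tr (M *m M ^t*) / n%:R = n%:R.
  have [n0 | n_gt0] := posnP n.
    have -> : n%:R = 0 :> C by rewrite n0.
    by rewrite invr0 mulr0.
  rewrite /mxtrace (eq_bigr (fun=> n%:R)) // sumr_const card_ord.
  by rewrite -[_ *+ _]mulr_natr mulfK // pnatr_eq0 -lt0n.
have /= := leif_det_gram M; rewrite mu det_tr det_Vandermonde.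
rewrite (eq_bigr (fun i : 'I_n => \prod_(j < n | (i < j)%N) (u j - u i)))
  => [|i _]; last by apply: eq_bigr => j _; rewrite !mxE.
suff -> : (M *m M ^t* == n%:R%:M) = [forall i, forall j, u i ^+ n == u j ^+ n]
  by [].
apply/eqP/'forall_forallP => [GM i j | un]; last first.
  apply/matrixP => i j; rewrite [RHS]mxE.
  have [-> | neq_ij] := eqVneq i j; first exact: G_diag.
  have uij : u i / u j - 1 != 0.
    rewrite subr_eq0 -(divff (u_neq0 j)) (inj_eq (mulIf _)) ?invr_eq0 //.
    by rewrite (inj_eq u_inj).
  apply: (mulfI uij); rewrite GE -subrX1 mulr0n mulr0.
  by rewrite expr_div_n (eqP (un i j)) divff ?expf_neq0 // subrr.
have [-> // | neq_ij] := eqVneq i j.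
have /matrixP/(_ i j) := GM; rewrite GE mxE (negPf neq_ij) mulr0n => Gij.
have := subrX1 (u i / u j) n; rewrite Gij mulr0 => /eqP.
rewrite subr_eq0 expr_div_n => /eqP eq1.
by rewrite -[u i ^+ n](divfK (expf_neq0 n (u_neq0 j))) eq1 mul1r.
Qed.

End Hadamard.

Local Open Scope complex_scope.

(** * The Cayley transform of the weighted problem *)

Definition cayley {R : realType} (a : R) (z : R[i]) : R[i] :=
  (z + (0 +i* a)) / (z - (0 +i* a)).

Lemma cmodE {R : realType} (z : R[i]) : (cmod z)%:C = `|z|.
Proof. by rewrite RRe_real ?normr_real. Qed.

Section Cayley.
Context {R : realType} {a : R} (a_gt0 : 0 < a).

Lemma real_subi_neq0 z : real_line z -> z - (0 +i* a) != 0.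
Proof.
move=> [x _ <-]; rewrite eq_complex /= negb_and orbC sub0r oppr_eq0.
by rewrite gt_eqF.
Qed.

Lemma norm_cayley z : real_line z -> `|cayley a z| = 1.
Proof.
move=> zR; have z0 := real_subi_neq0 _ zR; move: zR z0 => [x _ <-] z0.
rewrite normf_div -[`|x%:C + _|]normcJ.
have -> : (x%:C + (0 +i* a))^*%C = x%:C - (0 +i* a).
  by apply/eqP; rewrite eq_complex /= !add0r oppr0 addr0 !eqxx.
by rewrite divff // normr_eq0.
Qed.

Lemma cayleyB z1 z2 : real_line z1 -> real_line z2 ->
  cayley a z1 - cayley a z2 =
  - (2 * a)%:C * 'i * (z1 - z2) / ((z1 - (0 +i* a)) * (z2 - (0 +i* a))).
Proof.
move=> z1R z2R; rewrite /cayley.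
have := real_subi_neq0 _ z1R; have := real_subi_neq0 _ z2R.
have -> : - (2 * a)%:C * 'i = - (2 * (0 +i* a)) :> R[i].
  by apply/eqP; rewrite eq_complex /=; apply/andP; split; apply/eqP; ring.
set ai := 0 +i* a => z20 z10.
field.
by rewrite z10 z20.
Qed.

Lemma cayley_inj z1 z2 : real_line z1 -> real_line z2 ->
  cayley a z1 = cayley a z2 -> z1 = z2.
Proof.
move=> z1R z2R /eqP; rewrite -subr_eq0 cayleyB // !mulf_eq0 invr_eq0 mulf_eq0.
rewrite !(negPf (real_subi_neq0 _ _)) // !orbF subr_eq0 oppr_eq0.
rewrite eq_complex /= eqxx andbT (gt_eqF (mulr_gt0 _ _)) //=.
by rewrite eq_complex /= oner_eq0 andbF => /eqP.
Qed.

Lemma weighted_distance z1 z2 : real_line z1 -> real_line z2 ->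
  (cmod (z1 - z2) * wgt a z1 * wgt a z2)%:C =
  (2 * a)^-1%:C * `|cayley a z2 - cayley a z1|.
Proof.
move=> z1R z2R; rewrite cayleyB //.
have z10 := real_subi_neq0 _ z1R; have z20 := real_subi_neq0 _ z2R.
have : 0 < 2 * a by rewrite mulr_gt0.
move: (2 * a) => b b_gt0; rewrite /wgt !rmorphM !fmorphV /= !cmodE.
rewrite normf_div !normrM normrN.
have -> : `|'i%C : R[i]| = 1 by rewrite complexiE normCi.
rewrite distrC [`|b%:C|]ger0_norm ?ler0c ?ltW //.
have b0 : b%:C != 0 by rewrite fmorph_eq0 gt_eqF.
by rewrite mulr1 -!mulrA mulKf // invfM [_^-1 * _]mulrC.
Qed.

End Cayley.

Lemma prod_pairs_const {R : comPzRingType} (n : nat) (c : R) :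
  \prod_(j < n) \prod_(k < n | (j < k)%N) c = c ^+ 'C(n, 2).
Proof.
rewrite (exchange_big_dep xpredT) //= -triangular_sum big_mkord expr_sum.
apply: eq_bigr => k _.
have := big_ord_widen n (fun=> c) (ltnW (ltn_ord k)).
by move=> <-; rewrite prodr_const card_ord.
Qed.

(** The square removes the square root from Hadamard's bound, and makes the
    number n(n-1)/2 of pairs an exponent without a division. *)
Lemma leif_wprod_sqr {R : realType} {a : R} {n : nat} {z : 'I_n -> R[i]} :
  0 < a -> npoints (@real_line R) z ->
  (\prod_(j < n) \prod_(k < n | (j < k)%N)
     (cmod (z j - z k) * wgt a (z j) * wgt a (z k))) ^+ 2 <=
  ((2 * a)^-1) ^+ (n * n.-1) * n%:R ^+ n
    ?= iff [forall i, forall j, cayley a (z i) ^+ n == cayley a (z j) ^+ n].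
Proof.
move=> a_gt0 [z_inj zR].
have a2_gt0 : 0 < (2 * a)^-1 by rewrite invr_gt0 mulr_gt0.
set P := \prod_(j < n) _.
pose V : R[i] := \prod_(j < n) \prod_(k < n | (j < k)%N)
                   (cayley a (z k) - cayley a (z j)).
have PV : (P ^+ 2)%:C = ((2 * a)^-1 ^+ (n * n.-1))%:C * `|V| ^+ 2.
  have -> : (n * n.-1 = 'C(n, 2) * 2)%N.
    by rewrite [RHS]mulnC -(mul_bin_diag n 1) bin1.
  rewrite exprM -prod_pairs_const !rmorphXn /= -exprMn; congr (_ ^+ 2).
  rewrite !rmorph_prod normr_prod -big_split; apply: eq_bigr => j _ /=.
  rewrite !rmorph_prod normr_prod -big_split; apply: eq_bigr => k _ /=.
  exact: weighted_distance.
have u_inj : injective (cayley a \o z).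
  by move=> i j /= /(cayley_inj a_gt0 _ _ (zR i) (zR j)) /z_inj.
have u1 i : `|(cayley a \o z) i| = 1 by exact: norm_cayley.
have := leif_Vandermonde_circle u_inj u1; rewrite -/V => -[le_V eq_V].
have c_gt0 : 0 < ((2 * a)^-1 ^+ (n * n.-1))%:C by rewrite ltcR exprn_gt0.
have rhsE : ((2 * a)^-1 ^+ (n * n.-1) * n%:R ^+ n)%:C =
    ((2 * a)^-1 ^+ (n * n.-1))%:C * (n%:R ^+ n).
  by rewrite rmorphM; congr (_ * _); rewrite rmorphXn rmorph_nat.
split; first by rewrite -lecR PV rhsE ler_pM2l.
rewrite -eq_V -(inj_eq (@complexI R)) PV rhsE.
by rewrite (inj_eq (mulfI _)) // gt_eqF.
Qed.

(** Raising to the power 1/(n(n-1)) is strictly increasing on nonnegative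
    numbers, so it carries over both the bound and its equality case. *)
Lemma leif_wprod {R : realType} {a : R} {n : nat} {z : 'I_n -> R[i]} :
  0 < a -> (2 <= n)%N -> npoints (@real_line R) z ->
  wprod (wgt a) z <= (n%:R `^ (n.-1%:R)^-1) / (2 * a)
    ?= iff [forall i, forall j, cayley a (z i) ^+ n == cayley a (z j) ^+ n].
Proof.
move=> a_gt0 n_ge2 zP; have [le_P2 eq_P2] := leif_wprod_sqr a_gt0 zP.
have a2_ge0 : 0 <= (2 * a)^-1 by rewrite invr_ge0 mulr_ge0 // ltW.
have P_ge0 : 0 <= \prod_(j < n) \prod_(k < n | (j < k)%N)
    (cmod (z j - z k) * wgt a (z j) * wgt a (z k)).
  have cmod_ge0 (x : R[i]) : 0 <= cmod x by rewrite -ler0c cmodE.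
  do 2![apply: prodr_ge0 => ? _].
  by rewrite !mulr_ge0 // invr_ge0.
have N_gt0 : (0 < n * n.-1)%N.
  by case: n n_ge2 {zP le_P2 eq_P2 P_ge0 z} => [|[|]].
have NV_gt0 : 0 < (n * n.-1)%:R^-1 :> R by rewrite invr_gt0 ltr0n.
set P := \prod_(j < n) _ in le_P2 eq_P2 P_ge0.
set M := _ * _ in le_P2 eq_P2.
have M_ge0 : 0 <= M by rewrite mulr_ge0 // exprn_ge0.
have wE : wprod (wgt a) z = (P ^+ 2) `^ (n * n.-1)%:R^-1.
  by rewrite /wprod -/P powRrM powR_mulrn.
have rE : n%:R `^ (n.-1%:R)^-1 / (2 * a) = M `^ (n * n.-1)%:R^-1.
  rewrite /M powRM ?exprn_ge0 // mulrC -!powR_mulrn // -!powRrM.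
  rewrite divff ?pnatr_eq0 ?gtn_eqF // powRr1 //.
  by rewrite natrM [(n%:R * _)^-1]invfM mulVKf // pnatr_eq0 gtn_eqF // ltnW.
rewrite wE rE; split; first by rewrite ge0_ler_powR ?nnegrE ?sqr_ge0 // ltW.
rewrite -eq_P2; apply/eqP/eqP => [|-> //].
by apply: (powR_injective NV_gt0); rewrite nnegrE ?sqr_ge0.
Qed.

(** * Angles *)

Definition cis {R : realType} (t : R) : R[i] := cos t +i* sin t.

Lemma cisD {R : realType} (s t : R) : cis (s + t) = cis s * cis t.
Proof.
rewrite /cis cosD sinD; apply/eqP; rewrite eq_complex /= eqxx /=.
by rewrite addrC.
Qed.

Lemma cisX {R : realType} (t : R) n : cis t ^+ n = cis (t *+ n).
Proof.
elim: n => [|n IHn]; first by rewrite expr0 mulr0n /cis cos0 sin0.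
by rewrite exprS IHn mulrS cisD.
Qed.

Lemma cis_neq0 {R : realType} (t : R) : cis t != 0.
Proof.
apply/eqP => t0; have := cisD t (- t); rewrite t0 mul0r addrN /cis cos0 sin0.
by move=> [] /eqP; rewrite oner_eq0.
Qed.

(** The two numbers are conjugate, so they agree iff they are real. *)
Lemma cis_eqN {R : realType} (t : R) : (cis t == cis (- t)) = (sin t == 0).
Proof.
rewrite eq_complex /= cosN sinN eqxx /=.
by rewrite -addr_eq0 -mulr2n mulrn_eq0.
Qed.

(** Reduction of x modulo pi to [0, pi[, where the sine only vanishes at 0. *)
Lemma sin_eq0_ge0 {R : realType} {x : R} : 0 <= x -> sin x = 0 ->
  exists m, x = pi *+ m.
Proof.
move=> x_ge0 sinx; pose m := Num.truncn (x / pi).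
have /andP[] := truncn_itv (divr_ge0 x_ge0 (pi_ge0 R)); rewrite -/m.
rewrite ler_pdivlMr ?pi_gt0 // ltr_pdivrMr ?pi_gt0 // !mulr_natl mulrSr.
move=> mx xm; exists m; apply/eqP; rewrite eq_sym eq_le mx /= leNgt.
apply/negP => mx'; have : sin (x - pi *+ m) = 0.
  have := alternatingn (@sinDpi R) m (x - pi *+ m).
  by rewrite subrK sinx => /esym/eqP; rewrite mulf_eq0 signr_eq0 => /eqP.
by move/eqP; rewrite gt_eqF // sin_gt0_pi // subr_gt0 mx' ltrBlDl.
Qed.

Section TanPoints.
Context {R : realType} {a : R} (a_gt0 : 0 < a).

(** Together with tan_subi: a tan t +- ai = (a / cos t)(sin t +- i cos t). *)
Lemma tan_plusi t : cos t != 0 ->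
  (a * tan t)%:C + (0 +i* a) = (a / cos t)%:C * cis (pi / 2 - t).
Proof.
move=> t0; rewrite /cis cosB sinB cos_pihalf sin_pihalf /tan.
apply/eqP; rewrite eq_complex /=; apply/andP.
by split; apply/eqP; field.
Qed.

Lemma tan_subi t : cos t != 0 ->
  (a * tan t)%:C - (0 +i* a) = (a / cos t)%:C * cis (- (pi / 2 - t)).
Proof.
move=> t0; rewrite /cis cosN sinN cosB sinB cos_pihalf sin_pihalf /tan.
apply/eqP; rewrite eq_complex /=; apply/andP.
by split; apply/eqP; field.
Qed.

(** Cross-multiplication compares e^(in(t - s)) with its conjugate. *)
Lemma cayley_tan_eq n s t : cos s != 0 -> cos t != 0 ->
  (cayley a (a * tan s)%:C ^+ n == cayley a (a * tan t)%:C ^+ n) =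
  (sin ((t - s) *+ n) == 0).
Proof.
move=> s0 t0; rewrite /cayley !tan_plusi // !tan_subi //.
have c0 x : cos x != 0 -> (a / cos x)%:C != 0.
  by move=> x0; rewrite fmorph_eq0 mulf_neq0 ?invr_eq0 // gt_eqF.
rewrite -!mulf_div !divff ?c0 // !mul1r !expr_div_n !cisX.
rewrite eqr_div ?cis_neq0 // -!cisD.
have -> : (pi / 2 - s) *+ n + - (pi / 2 - t) *+ n = (t - s) *+ n by ring.
have -> : (pi / 2 - t) *+ n + - (pi / 2 - s) *+ n = - ((t - s) *+ n) by ring.
exact: cis_eqN.
Qed.

Definition node (n : nat) (gamma : R) (k : nat) : R :=
  gamma + k%:R * pi / n%:R.

Section Nodes.
Context {n : nat} {gamma : R} (n_gt0 : (0 < n)%N).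
Context (gamma_itv : - (pi / 2) < gamma < - (pi / 2) + pi / n%:R).

Let nR : 0 < n%:R :> R. Proof. by rewrite ltr0n. Qed.

Lemma node_itv k : (k < n)%N -> node n gamma k \in `](- (pi / 2)), (pi / 2)[.
Proof.
move=> kn; rewrite in_itv /node /=.
have /andP[g1 g2] := gamma_itv.
have k0 : 0 <= k%:R * pi / n%:R :> R.
  by rewrite !mulr_ge0 ?pi_ge0 ?invr_ge0.
have : k.+1%:R * pi / n%:R <= pi :> R.
  by rewrite ler_pdivrMr // mulrC ler_wpM2l ?pi_ge0 // ler_nat.
rewrite -natr1 mulrDl mul1r mulrDl => k1.
have := splitr (pi : R) => ?.
by apply/andP; split; lra.
Qed.

Lemma cos_node k : (k < n)%N -> cos (node n gamma k) != 0.
Proof. by move=> /node_itv; rewrite in_itv => /cos_gt0_pihalf/gt_eqF ->. Qed.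

Lemma node_inj : injective (node n gamma).
Proof.
have n0 : n%:R^-1 != 0 :> R by rewrite invr_eq0 gt_eqF.
have pi0 : pi != 0 :> R by rewrite gt_eqF ?pi_gt0.
by move=> j k /addrI /(mulIf n0) /(mulIf pi0) /eqP; rewrite eqr_nat => /eqP.
Qed.

Lemma tan_node_inj :
  {in gtn n &, injective (fun k => (a * tan (node n gamma k))%:C)}.
Proof.
move=> j k jn kn /complexI /(mulfI (lt0r_neq0 a_gt0)) /tan_inj.
by move=> /(_ (node_itv _ jn) (node_itv _ kn)) /node_inj.
Qed.

Lemma sin_node_eq0 j k : sin ((node n gamma j - node n gamma k) *+ n) = 0.
Proof.
have -> : (node n gamma j - node n gamma k) *+ n = pi *+ j - pi *+ k.
  rewrite /node; field.
  by rewrite gt_eqF.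
have sinpin i : sin (pi *+ i) = 0 :> R.
  by rewrite -[pi *+ i]add0r (alternatingn (@sinDpi R)) sin0 mulr0.
by rewrite sinB !sinpin mulr0 mul0r subrr.
Qed.

End Nodes.
End TanPoints.

(** * The Fekete polynomial *)

Lemma coefPn_XsubC_exp {K : idomainType} (c : K) n : (0 < n)%N ->
  (('X - c%:P) ^+ n)`_n.-1 = - c *+ n.
Proof.
move=> n_gt0; have := @coefPn_prod_XsubC _ (nseq n c).
rewrite size_nseq -lt0n n_gt0 !big_nseq iter_mulr_1 iter_addr_0 => -> //.
by rewrite mulNrn.
Qed.

Section FeketePoly.
Context {R : realType} {a : R} (a_gt0 : 0 < a).
Context {n : nat} (n_gt0 : (0 < n)%N).
Context (B : R).
Local Notation F := (fekete_poly a n B).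

Let s_neq0 : (2 * a * n%:R)%:C != 0.
Proof. by rewrite fmorph_eq0 !mulf_neq0 ?gt_eqF // ltr0n. Qed.

Let F_XsubC : F = (2 * a * n%:R)^-1%:C *:
    ((a * n%:R -i* B) *: ('X - (- (0 +i* a))%:P) ^+ n +
     (a * n%:R +i* B) *: ('X - (0 +i* a)%:P) ^+ n).
Proof. by rewrite polyCN opprK. Qed.

Lemma size_fekete_poly_le : (size F <= n.+1)%N.
Proof.
rewrite F_XsubC (leq_trans (size_scale_leq _ _)) //.
rewrite (leq_trans (size_polyD _ _)) // geq_max.
by rewrite !(leq_trans (size_scale_leq _ _)) // size_exp_XsubC.
Qed.

Lemma coefn_fekete_poly : F`_n = 1.
Proof.
have c1 c : (('X - c%:P) ^+ n : {poly R[i]})`_n = 1.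
  have /monicP := monic_exp n (monicXsubC c).
  by rewrite lead_coefE size_exp_XsubC.
rewrite F_XsubC coefZ coefD !coefZ !c1 !mulr1 fmorphV.
apply: (mulfI s_neq0); rewrite mulVKf // mulr1.
apply/eqP; rewrite eq_complex /= addNr eqxx andbT; apply/eqP; ring.
Qed.

Lemma coefPn_fekete_poly : F`_n.-1 = B%:C.
Proof.
rewrite F_XsubC coefZ coefD !coefZ !coefPn_XsubC_exp // opprK fmorphV.
apply: (mulfI s_neq0); rewrite mulVKf //.
have mulrnE (c : R[i]) : c *+ n = n%:R%:C * c by rewrite rmorph_nat mulr_natl.
rewrite !mulrnE.
by apply/eqP; rewrite eq_complex /=; apply/andP; split; apply/eqP; ring.
Qed.

Lemma size_fekete_poly : size F = n.+1.
Proof.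
apply/eqP; rewrite eqn_leq size_fekete_poly_le ltnNge; apply/negP => sF.
have := coefn_fekete_poly; rewrite nth_default // => /esym/eqP.
by rewrite oner_eq0.
Qed.

Lemma monic_fekete_poly : F \is monic.
Proof.
by apply/monicP; rewrite lead_coefE size_fekete_poly coefn_fekete_poly.
Qed.

End FeketePoly.

Section Roots.
Context {R : realType} {a : R} (a_gt0 : 0 < a).
Context {n : nat} (n_gt0 : (0 < n)%N) {gamma : R}.
Context (gamma_itv : - (pi / 2) < gamma < - (pi / 2) + pi / n%:R).

Let phi := n%:R * pi / 2 + n%:R * gamma.

Let sin_phi : sin phi != 0.
Proof.
have nR : 0 < n%:R :> R by rewrite ltr0n.
have /andP[g1 g2] := gamma_itv.
rewrite gt_eqF // sin_gt0_pi // /phi -mulrA -mulrDr.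
rewrite mulr_gt0 //=; last by lra.
by rewrite mulrC -ltr_pdivlMr //; lra.
Qed.

(** With psi = n(pi/2 - t_k), the value is proportional to
    cos(psi) + cot(phi) sin(psi) = sin(phi + psi) / sin(phi), and
    phi + psi = (n - k) pi. *)
Lemma root_fekete_poly_node k : (k < n)%N ->
  root (fekete_poly a n (a * n%:R * cot phi)) (a * tan (node n gamma k))%:C.
Proof.
move=> kn; have c0 := cos_node n_gt0 gamma_itv _ kn.
rewrite rootE /fekete_poly hornerZ hornerD !hornerZ !horner_exp.
rewrite !(hornerD, hornerN, hornerX, hornerC).
rewrite tan_plusi // tan_subi // !exprMn !cisX mulNrn.
set psi := (_ - node n gamma k) *+ n.
have phi_psi : sin (phi + psi) = 0.
  have -> : phi + psi = (pi *+ (n - k)).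
    rewrite mulrnBr; last exact: ltnW.
    rewrite /psi /node /phi; field.
    by rewrite pnatr_eq0 -lt0n.
  by rewrite -[pi *+ _]add0r (alternatingn (@sinDpi R)) sin0 mulr0.
set c := _%:C ^+ n.
(* factor out the constant and c, leaving a real combination of cos psi and
   sin psi *)
rewrite mulrCA [X in _ + X]mulrCA -mulrDr mulrCA mulf_eq0; apply/orP; right.
rewrite mulf_eq0; apply/orP; right.
rewrite /cis cosN sinN /cot.
move: phi_psi; rewrite sinD => phi_psi.
rewrite eq_complex /=; apply/andP; split; apply/eqP; last by ring.
transitivity (2 * a * n%:R / sin phi * (sin phi * cos psi + cos phi * sin psi)).
  by field.
by rewrite phi_psi mulr0.
Qed.

Lemma fekete_poly_prod : fekete_poly a n (a * n%:R * cot phi) =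
  \prod_(z <- [seq (a * tan (node n gamma k))%:C | k <- iota 0 n])
     ('X - z%:P).
Proof.
set F := fekete_poly _ _ _; set s := map _ _.
suff -> : F = lead_coef F *: \prod_(z <- s) ('X - z%:P).
  by rewrite (monicP (monic_fekete_poly _ _ _)) // scale1r.
apply: all_roots_prod_XsubC.
- by rewrite size_fekete_poly // size_map size_iota.
- apply/allP => w /mapP[k]; rewrite mem_iota add0n => /= kn wE.
  by rewrite wE; exact: root_fekete_poly_node.
- rewrite uniq_rootsE map_inj_in_uniq ?iota_uniq // => j k.
  rewrite !mem_iota !add0n /= => jn kn.
  exact: (tan_node_inj a_gt0 n_gt0 gamma_itv).
Qed.

(** Both sides are the coefficient of degree n - 1 of the Fekete polynomial. *)
Lemma Bcoef_cot : Bcoef a n gamma = a * n%:R * cot phi.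
Proof.
apply: (@complexI R).
have := coefPn_fekete_poly a_gt0 n_gt0 (a * n%:R * cot phi).
rewrite fekete_poly_prod; set s := map _ _ => <-.
have sz_s : size s = n by rewrite size_map size_iota.
have := @coefPn_prod_XsubC _ s; rewrite sz_s -lt0n => -> //.
rewrite big_map -rmorph_sum -rmorphN /= /Bcoef mulNr mulr_sumr.
rewrite -(big_mkord xpredT (fun k => a * tan (node n gamma k))).
by rewrite /index_iota subn0.
Qed.

Lemma tan_points_roots :
  tan_points a n gamma = [set z | root (fekete_poly a n (Bcoef a n gamma)) z].
Proof.
rewrite Bcoef_cot fekete_poly_prod.
apply/seteqP; split => z /=; rewrite root_prod_XsubC.
  by move=> [k /= kn <-]; apply/mapP; exists k; rewrite // mem_iota.
by move=> /mapP[k]; rewrite mem_iota => /= kn ->; exists k.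
Qed.

End Roots.

(** * Extremal configurations *)

(** Starting from the smallest angle gamma, the other angles are
    gamma + m pi/n with 0 <= m < n; as there are n of them, every m occurs, and
    the occurrence of m = n - 1 below pi/2 is the upper bound on gamma. *)
Lemma fekete_angles {R : realType} {a : R} {n : nat} {z : 'I_n -> R[i]} :
  0 < a -> (0 < n)%N -> npoints (@real_line R) z ->
  (forall i j, cayley a (z i) ^+ n = cayley a (z j) ^+ n) ->
  exists2 gamma : R, - (pi / 2) < gamma < - (pi / 2) + pi / n%:R &
    range z = tan_points a n gamma.
Proof.
move=> a_gt0 n_gt0 [z_inj zR] zn.
have nR : 0 < n%:R :> R by rewrite ltr0n.
pose t k := atan (complex.Re (z k) / a).
have zE k : z k = (a * tan (t k))%:C.
  rewrite /t atanK mulrCA divff ?gt_eqF // mulr1.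
  by have [x _ <-] := zR k.
have t_cos k : cos (t k) != 0.
  by rewrite gt_eqF // cos_gt0_pihalf // atan_gtNpi2 atan_ltpi2.
have t_inj : injective t by move=> j k tjk; apply: z_inj; rewrite !zE tjk.
pose i0 := [arg min_(i < Ordinal n_gt0) t i]%O; pose gamma := t i0.
have t_ge k : gamma <= t k.
  by rewrite /gamma /i0; case: arg_minP => // i _; exact.
have t_node k : exists m : 'I_n, t k = node n gamma m.
  have /sin_eq0_ge0[|m tm] : sin ((t k - gamma) *+ n) = 0.
  - apply/eqP; rewrite -(cayley_tan_eq a_gt0 n (t i0) (t k)) // -!zE.
    exact/eqP.
  - by rewrite mulrn_wge0 // subr_ge0.
  have tkE : t k = node n gamma m.
    apply: (addIr (- gamma)); apply: (mulIf (lt0r_neq0 nR)).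
    by rewrite mulr_natr tm /node; field; rewrite gt_eqF.
  have mn : (m < n)%N.
    rewrite -(ltr_nat R) -(ltr_pM2l (pi_gt0 R)) !mulr_natr -tm.
    rewrite ltr_pMn2r //.
    have := atan_gtNpi2 (complex.Re (z i0) / a); rewrite -/(t i0) -/gamma.
    have := atan_ltpi2 (complex.Re (z k) / a); rewrite -/(t k).
    by have := splitr (pi : R); lra.
  by exists (Ordinal mn).
have [f tf] := fin_all_exists t_node.
have f_inj : injective f by move=> j k fjk; apply: t_inj; rewrite !tf fjk.
have [g gK fK] := injF_bij f_inj.
have gamma_itv : - (pi / 2) < gamma < - (pi / 2) + pi / n%:R.
  rewrite atan_gtNpi2 /=.
  have n1 : (n.-1 < n)%N by rewrite prednK.
  have := atan_ltpi2 (complex.Re (z (g (Ordinal n1))) / a).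
  rewrite -/(t _) tf fK /node /=.
  have -> : n.-1%:R * pi / n%:R = pi - pi / n%:R :> R.
    by rewrite -subn1 natrB //; field; rewrite gt_eqF.
  by have := splitr (pi : R); lra.
exists gamma => //; apply/seteqP; split => w /=.
  by move=> [k _ <-]; exists (f k) => /=; rewrite // zE tf.
move=> [k /= kn <-]; exists (g (Ordinal kn)) => //.
by rewrite zE tf fK.
Qed.

Lemma wprod_tan_points {R : realType} {a : R} {n : nat} {gamma : R} :
  0 < a -> (2 <= n)%N -> - (pi / 2) < gamma < - (pi / 2) + pi / n%:R ->
  let z (k : 'I_n) : R[i] := (a * tan (node n gamma k))%:C in
  npoints (@real_line R) z /\
  wprod (wgt a) z = (n%:R `^ (n.-1%:R)^-1) / (2 * a).
Proof.
move=> a_gt0 n_ge2 g_itv z; have n_gt0 : (0 < n)%N by exact: ltnW.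
have zP : npoints (@real_line R) z.
  split=> [j k zjk|k]; last by exists (a * tan (node n gamma k)).
  apply: val_inj.
  exact: (tan_node_inj a_gt0 n_gt0 g_itv _ _ (ltn_ord j) (ltn_ord k) zjk).
split => //; apply/eqP; rewrite (leif_wprod a_gt0 n_ge2 zP).
apply/'forall_forallP => j k.
rewrite /z cayley_tan_eq ?cos_node //.
by apply/eqP; exact: sin_node_eq0.
Qed.

Lemma wdiam_real_line {R : realType} {a : R} {n : nat} :
  0 < a -> (2 <= n)%N ->
  wdiam (@real_line R) (wgt a) n =
    ((n%:R `^ (n.-1%:R)^-1) / (2 * a))%:E.
Proof.
move=> a_gt0 n_ge2; apply/eqP; rewrite eq_le; apply/andP; split.
  apply: ub_ereal_sup => _ [z zP <-]; rewrite lee_fin.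
  exact: (leif_wprod a_gt0 n_ge2 zP).
have pin : 0 < pi / n%:R :> R by rewrite divr_gt0 ?pi_gt0 // ltr0n ltnW.
pose gamma : R := - (pi / 2) + pi / n%:R / 2.
have g_itv : - (pi / 2) < gamma < - (pi / 2) + pi / n%:R.
  by rewrite /gamma; apply/andP; split; lra.
have [zP <-] := wprod_tan_points a_gt0 n_ge2 g_itv.
by apply: ereal_sup_ubound; eexists; first exact: zP.
Qed.

Theorem theorem1p1 (R : realType) (a : R) (n : nat) (ha : 0 < a)
    (hn : (2 <= n)%N) :
  [/\ (forall F : set R[i], is_fekete (@real_line R) (wgt a) n F ->
         exists gamma : R,
           [/\ - (pi / 2) < gamma < - (pi / 2) + pi / n%:R,
               F = tan_points a n gamma &
               F = [set x | root (fekete_poly a n (Bcoef a n gamma)) x]]),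
      (forall gamma : R, - (pi / 2) < gamma < - (pi / 2) + pi / n%:R ->
         [/\ Bcoef a n gamma =
               a * n%:R * cot (n%:R * pi / 2 + n%:R * gamma),
             fekete_poly a n (Bcoef a n gamma) \is monic &
             tan_points a n gamma =
               [set x | root (fekete_poly a n (Bcoef a n gamma)) x]]) &
      wdiam (@real_line R) (wgt a) n =
        ((n%:R `^ (n.-1%:R)^-1) / (2 * a))%:E].
Proof.
have n_gt0 : (0 < n)%N by exact: ltnW.
split; last exact: wdiam_real_line.
- move=> F [z [zP ->]]; rewrite wdiam_real_line // => -[/eqP].
  rewrite (leif_wprod ha hn zP) => /'forall_forallP zn.
  have [gamma g_itv zE] := fekete_angles ha n_gt0 zP (fun i j => eqP (zn i j)).
  by exists gamma; split=> //; rewrite zE tan_points_roots.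
- move=> gamma g_itv; split; first exact: Bcoef_cot.
  + exact: monic_fekete_poly.
  + exact: tan_points_roots.
Qed.
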